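(* Consider an exponential family on a separable metric space $(\Omega,d)$ in natural parametrization, i.e. probability measures $\mu_\eta$ with densities $p_\eta(x)=h(x)\exp\{\eta^\top T(x)-A(\eta)\}$, $\eta\in\mathcal H$, with respect to a common dominating measure $\nu$, where the natural parameter space $\mathcal H\subset\mathbb R^p$ is open, $T:\Omega\to\mathbb R^p$ is measurable, $A:\mathcal H\to\mathbb R$, and the Fisher information matrix $\mathcal I_\eta=\partial^2A(\eta)/(\partial\eta\,\partial\eta^\top)$ is non-singular. Then, for every $\eta_0\in\mathcal H$, the map $\eta\mapsto F^{\mu_\eta}$ is differentiable at $\eta_0$ as a map from $\mathcal H$ into $\ell^\infty(\Omega\times\mathbb R_{\ge0})$, equivalently, $$\sup_{\omega\in\Omega,t\ge0}\big|F_\omega^{\mu_\eta}(t)-F_\omega^{\mu_{\eta_0}}(t)-\dot F_\omega^{\eta_0}(t)^\top(\eta-\eta_0)\big|=o(\|\eta-\eta_0\|)\quad\text{as }\eta\to\eta_0.$$ Moreover, for each $\omega\in\Omega$ and $t\ge0$, $$\dot F_\omega^{\eta_0}(t)=\mathsf E\big(1_{\{d(\omega,X)\le t\}}\,\psi_{\eta_0}(X)\big),\qquad X\sim\mu_{\eta_0},$$ where $\psi_\eta(x)=T(x)-\partial A(\eta)/\partial\eta$ is the score function.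
   Context: The distance profile of $\mu_\eta$ at $\omega$ is $F_\omega^{\mu_\eta}(t)=\mu_\eta(\{x:d(\omega,x)\le t\})$, $t\ge0$, and $\dot F_\omega^{\eta_0}(t)=\partial F_\omega^{\mu_\eta}(t)/\partial\eta|_{\eta=\eta_0}\in\mathbb R^p$. $A$ is the log-normalizer, so that $\int p_\eta\,\mathrm d\nu=1$ for every $\eta\in\mathcal H$. *)

(* Defs.v *)
From HB Require Import structures.
From mathcomp Require Import all_boot all_order all_algebra.
From mathcomp Require Import all_classical all_reals all_analysis.

Set Implicit Arguments.
Unset Strict Implicit.
Unset Printing Implicit Defensive.

Import Order.TTheory GRing.Theory Num.Theory.
Import numFieldNormedType.Exports.

Local Open Scope classical_set_scope.
Local Open Scope ring_scope.

(* Borel sigma-algebras are built with g_sigma_algebraType, which needs a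
   pointed carrier; a space carrying a probability measure is nonempty. *)
#[short(type="pmetricType")]
HB.structure Definition PointedMetric (R : numDomainType) :=
  {T of Metric R T & Pointed T}.

(* The normed space l^oo(T) of bounded real functions on an arbitrary type T,
   with the supremum norm. *)
Section linfty.
Context {T : Type} {R : realType}.

Definition linfty_pred : {pred T -> R} :=
  fun f => `[< has_ubound (range (fun x => `|f x|)) >].

Record linfty : Type := Linfty {
  linfty_val :> T -> R ;
  linftyP : linfty_val \in linfty_pred }.

HB.instance Definition _ := [isSub for linfty_val].
HB.instance Definition _ := [Choice of linfty by <:].

Lemma linfty_submod_closed : submod_closed linfty_pred.
Proof.
split.
  by apply/asboolP; exists 0 => _ /= [x _ <-]; rewrite normr0.
move=> a f g /asboolP[M Mf] /asboolP[N Ng].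
apply/asboolP; exists (`|a| * M + N) => _ /= [x _ <-].
rewrite (le_trans (ler_normD _ _))// lerD//; last by apply: Ng; exists x.
by rewrite normrM ler_wpM2l//; apply: Mf; exists x.
Qed.

HB.instance Definition _ :=
  GRing.isSubmodClosed.Build R (T -> R) linfty_pred linfty_submod_closed.
HB.instance Definition _ := [SubChoice_isSubLmodule of linfty by <:].

Definition linfty_norm (f : linfty) : R := sup (range (fun x => `|f x|)).

Lemma linfty_norm_ub (f : linfty) x : `|f x| <= linfty_norm f.
Proof. by apply: ub_le_sup; [exact/asboolP/linftyP|exists x]. Qed.

Lemma linfty_norm_le (f : linfty) (M : R) :
  0 <= M -> (forall x, `|f x| <= M) -> linfty_norm f <= M.
Proof.
move=> M0 fM; rewrite /linfty_norm.
have [->|/set0P f0] := eqVneq (range (fun x => `|f x|)) set0.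
  by rewrite sup0.
by apply: ge_sup => // _ [x _ <-].
Qed.

Lemma linfty_norm_ge0 (f : linfty) : 0 <= linfty_norm f.
Proof.
rewrite /linfty_norm.
have [->|/set0P[_ [x _ _]]] := eqVneq (range (fun x => `|f x|)) set0.
  by rewrite sup0.
exact: le_trans (linfty_norm_ub f x).
Qed.

Lemma ler_linfty_normD (f g : linfty) :
  linfty_norm (f + g) <= linfty_norm f + linfty_norm g.
Proof.
apply: linfty_norm_le => [|x]; first by rewrite addr_ge0// linfty_norm_ge0.
by rewrite (le_trans (ler_normD _ _))// lerD// linfty_norm_ub.
Qed.

Lemma linfty_norm0_eq0 (f : linfty) : linfty_norm f = 0 -> f = 0.
Proof.
move=> f0; apply/val_inj/funext => x /=; apply/eqP.
by rewrite -normr_le0 -f0 linfty_norm_ub.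
Qed.

Lemma linfty_normZ (a : R) (f : linfty) :
  linfty_norm (a *: f) = `|a| * linfty_norm f.
Proof.
have leZ (b : R) (g : linfty) : linfty_norm (b *: g) <= `|b| * linfty_norm g.
  apply: linfty_norm_le => [|x]; first by rewrite mulr_ge0// linfty_norm_ge0.
  by rewrite [_ x]/(b * g x) normrM ler_wpM2l// linfty_norm_ub.
apply/eqP; rewrite eq_le leZ/=.
have [->|a0] := eqVneq a 0; first by rewrite normr0 mul0r linfty_norm_ge0.
rewrite -[f in leLHS](scalerK a0) -ler_pdivlMl ?normr_gt0//.
by rewrite -normfV leZ.
Qed.

HB.instance Definition _ := @Lmodule_isNormed.Build R linfty
  linfty_norm ler_linfty_normD linfty_normZ linfty_norm0_eq0.

End linfty.
Arguments linfty : clear implicits.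

Notation borel T := (g_sigma_algebraType (@open T)).

Definition separable (T : topologicalType) : Prop :=
  exists2 S : set T, countable S & dense S.

(* Elements of R^p are row vectors; the norm `|_| on 'rV[R]_p is the maximum
   norm, which is equivalent to the Euclidean one. *)
Section euclidean.
Context {R : realType} {p : nat}.

Definition dotmul (u v : 'rV[R]_p) : R := \sum_(i < p) u 0 i * v 0 i.

Definition pderive (i : 'I_p) (f : 'rV[R]_p -> R) (x : 'rV[R]_p) : R :=
  'D_(delta_mx 0 i) f x.

Definition gradient (f : 'rV[R]_p -> R) (x : 'rV[R]_p) : 'rV[R]_p :=
  \row_i pderive i f x.

Definition hessian (f : 'rV[R]_p -> R) (x : 'rV[R]_p) : 'M[R]_p :=
  \matrix_(i, j) pderive i (pderive j f) x.

End euclidean.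

Section exponential_family.
Context {R : realType} {Omega : Type} {p : nat}.
Variables (h : Omega -> R) (T : Omega -> 'rV[R]_p) (A : 'rV[R]_p -> R).

Definition expfam_density (eta : 'rV[R]_p) (x : Omega) : R :=
  h x * expR (dotmul eta (T x) - A eta).

Definition score (eta : 'rV[R]_p) (x : Omega) : 'rV[R]_p :=
  T x - gradient A eta.

Definition fisher_information (eta : 'rV[R]_p) : 'M[R]_p := hessian A eta.

End exponential_family.

Section distance_profile.
Context {R : realType} {Omega : pmetricType R}.
Implicit Type mu : probability (borel Omega) R.

Definition mball (omega : Omega) (t : R) : set (borel Omega) :=
  [set x : Omega | mdist omega x <= t].

Definition distance_profile mu (omega : Omega) (t : R) : R :=
  fine (mu (mball omega t)).

Definition distance_profile_fun mu (z : Omega * {nonneg R}) : R :=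
  distance_profile mu z.1 z.2%:num.

Lemma mball_measurable omega t : measurable (mball omega t).
Proof.
rewrite -[mball _ _]setCK; apply: measurableC; apply: sub_gen_smallest.
rewrite openE => x /= /negP; rewrite -ltNge => tx.
apply/nbhs_ballP; exists (mdist omega x - t) => /=; first by rewrite subr_gt0.
move=> y; rewrite ballEmdist/= => xy; apply/negP; rewrite -ltNge.
have := metric_triangle omega y x; rewrite (metric_sym y x) => oyx.
by rewrite -(ltrD2r (mdist x y)) (lt_le_trans _ oyx)// addrC -ltrBrDr.
Qed.

Lemma distance_profile_bounded mu :
  distance_profile_fun mu \in @linfty_pred (Omega * {nonneg R}) R.
Proof.
apply/asboolP; exists 1 => _ /= [z _ <-].
have mB := mball_measurable z.1 z.2%:num.
rewrite ger0_norm ?fine_ge0// -lee_fin fineK ?fin_num_measure//.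
exact: probability_le1.
Qed.

Definition distance_profile_linfty mu : linfty (Omega * {nonneg R}) R :=
  Linfty (distance_profile_bounded mu).

Definition distance_profile_dot {p : nat}
    (mu : 'rV[R]_p -> probability (borel Omega) R)
    (eta0 : 'rV[R]_p) (omega : Omega) (t : R) : 'rV[R]_p :=
  gradient (fun eta => distance_profile (mu eta) omega t) eta0.

End distance_profile.

(* Main.v *)
Require Import Defs.
From HB Require Import structures.
From mathcomp Require Import all_boot all_order all_algebra.
From mathcomp Require Import all_classical all_reals all_analysis.
From mathcomp Require Import measurable_realfun ring lra.
Set Implicit Arguments.
Unset Strict Implicit.
Unset Printing Implicit Defensive.
Import Order.TTheory GRing.Theory Num.Theory.
Import numFieldNormedType.Exports.
Local Open Scope classical_set_scope.
Local Open Scope ring_scope.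

(** Write P for the law at eta0 and v(u) = A(eta0 + u) - A(eta0).  The law at
    eta0 + u is the exponential tilt of P: it has P-density exp(u.T - v(u)).
    Both the profile and the normalizer are thus governed by the partial Laplace
    transforms L_B(u) = int_B exp(u.T) dP, with B a closed ball or the whole
    space, through mu_(eta0 + u)(B) = L_B(u) / L_Omega(u) and
    v(u) = ln L_Omega(u).

    The heart of the matter is that L_B has a second order expansion whose
    remainder does not depend on B.  From |e^y - 1 - y| <= y^2 e^|y| one gets
    |L_B(u) - P(B) - u.int_B T dP| <= K |u|^2, where K is the P-integral of an
    envelope proportional to exp(3 r |T|_1); it bounds the remainder over any
    B, since the integral over B of a nonnegative function is at most that over
    the whole space ([laplace_expansion]).  The envelope is integrable because
    H is open: exp(delta |T|_1) is at most the sum of exp(u.T) over the 2^p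
    corners u of a cube of half-side delta, and for delta small all the points
    eta0 + u lie in H ([integrable_expR_l1norm]).

    Dividing by L_Omega(u) = 1 + u.m + O(|u|^2), with m = int T dP, gives
    mu_(eta0 + u)(B) = P(B) + u.int_B (T - m) dP + O(|u|^2) uniformly in B, and
    taking logarithms v(u) = u.m + O(|u|^2) ([tilt_expansion]).  The second
    expansion identifies m with the gradient of A, so that T - m is the score.
    The first one is a quadratic bound on the remainder, which yields at once
    the partial derivatives of each profile, the uniform estimate, and the
    differentiability in the sup norm
    ([differentiable_quadratic_remainder]). *)

(** * Differentiability from a quadratic remainder bound *)

Lemma ler_norm_coord (R : realType) (p : nat) (u : 'rV[R]_p) i :
  `|u 0 i| <= `|u|.
Proof.
rewrite [leRHS]mx_normrE.
exact: (le_bigmax _ (fun ij : 'I_1 * 'I_p => `|u ij.1 ij.2|) (0, i)).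
Qed.

Section quadratic_remainder.
Context {R : realType} {p : nat} {W : normedModType R}.

(** The linear map whose value on the i-th unit vector is [e i]; every linear map
    on row vectors has this form, so that [e] lists the candidate partial
    derivatives of a function with values in [W]. *)
Definition row_combination (e : 'I_p -> W) (u : 'rV[R]_p) : W :=
  \sum_(i < p) u 0 i *: e i.

Lemma row_combination_is_linear e : linear (row_combination e).
Proof.
move=> a u v; rewrite /row_combination scaler_sumr -big_split/=.
by apply: eq_bigr => i _; rewrite !mxE scalerDl scalerA.
Qed.

HB.instance Definition _ e := GRing.isLinear.Build R 'rV[R]_p W *:%R
  (row_combination e) (row_combination_is_linear e).

Lemma row_combination_delta e i : row_combination e (delta_mx 0 i) = e i.
Proof.
rewrite /row_combination (bigD1 i)//= mxE !eqxx scale1r big1 ?addr0// => j ji.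
by rewrite mxE (negPf ji) andbF scale0r.
Qed.

Lemma continuous_row_combination e : continuous (row_combination e).
Proof.
apply/linear_bounded_continuous/bounded_funP => r.
exists (\sum_(i < p) r * `|e i|) => u ur.
apply: le_trans (ler_norm_sum _ _ _) _; apply: ler_sum => i _.
by rewrite normrZ ler_wpM2r// (le_trans (ler_norm_coord _ _)).
Qed.

(** A remainder O(|u|^2) is o(|u|).  The target [W] is kept general so that the
    same statement serves real functions and maps into a space of bounded
    functions. *)
Lemma differentiable_quadratic_remainder (f : 'rV[R]_p -> W) (x : 'rV[R]_p) e (r C : R) :
  0 < r ->
  (forall u, `|u| <= r ->
    `|f (x + u) - f x - row_combination e u| <= C * `|u| ^+ 2) ->
  differentiable f x /\ forall i, 'D_(delta_mx 0 i) f x = e i.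
Proof.
move=> r0 fC.
have C1 : 0 < `|C| + 1 by rewrite ltr_wpDl.
have small (eps : R) : 0 < eps -> \forall u \near (0 : 'rV[R]_p),
    `|f (u + x) - (f x + row_combination e u)| <= eps * `|u|.
  move=> eps0; near=> u.
  rewrite opprD addrA [u + x]addrC.
  have ur : `|u| <= r by near: u; exact: (@nbhs0_le _ 'rV[R]_p).
  apply: le_trans (fC u ur) _; rewrite expr2 mulrA ler_wpM2r//.
  rewrite (@le_trans _ _ ((`|C| + 1) * `|u|))//.
    by rewrite ler_wpM2r// (le_trans (ler_norm _))// lerDl.
  rewrite -ler_pdivlMl// mulrC.
  by near: u; apply: (@nbhs0_le _ 'rV[R]_p); rewrite divr_gt0.
have expand : f \o shift x = cst (f x) + row_combination e +o_ (0 : 'rV[R]_p) id.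
  by apply/eqaddoP; exact: small.
have dfE := diff_unique (@continuous_row_combination e) expand.
have df : differentiable f x.
  apply/diff_locallyP; rewrite dfE; split=> //.
  exact: continuous_row_combination.
split=> // i; rewrite deriveE// dfE; exact: row_combination_delta.
Unshelve. all: by end_near. Qed.

End quadratic_remainder.

(** * Integration against a measure with a density *)

Section integral_density.
Context d (X : measurableType d) (R : realType).
Variables (nu P : {measure set X -> \bar R}) (q : X -> R).
Hypothesis q_ge0 : forall x, 0 <= q x.
Hypothesis measurable_q : measurable_fun [set: X] q.
Hypothesis P_density : forall B, measurable B ->
  P B = (\int[nu]_(x in B) (q x)%:E)%E.

Import HBNNSimple.

Lemma integral_density_nnsfun (D : set X) (g : {nnsfun X >-> R}) :
  measurable D ->
  (\int[P]_(x in D) (g x)%:E = \int[nu]_(x in D) (g x * q x)%:E)%E.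
Proof.
move=> mD.
have term_ge0 y x : 0 <= y * \1_(g @^-1` [set y]) x.
  have := nnfun_muleindic_ge0 g y x; by rewrite lee_fin.
have gE x : g x = \sum_(y \in range g) y * \1_(g @^-1` [set y]) x.
  exact: fimfunE.
have mterm y : measurable_fun D (fun x => y * \1_(g @^-1` [set y]) x : R).
  by apply: measurable_funM => //; exact: measurable_indic.
have mq : measurable_fun D q by exact: measurable_funTS.
transitivity (\sum_(y \in range g)
    \int[P]_(x in D) (y * \1_(g @^-1` [set y]) x)%:E)%E.
  rewrite -ge0_integral_fsum//.
  - by apply: eq_integral => x _; rewrite gE -fsumEFin.
  - by move=> y; apply/measurable_EFinP.
  - by move=> y x _; rewrite lee_fin.
transitivity (\sum_(y \in range g)
    \int[nu]_(x in D) (y * \1_(g @^-1` [set y]) x * q x)%:E)%E; last first.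
  rewrite -ge0_integral_fsum//.
  - apply: eq_integral => x _; rewrite fsumEFin// [in RHS]gE.
    by rewrite mulr_fsuml.
  - by move=> y; apply/measurable_EFinP/measurable_funM.
  - by move=> y x _; rewrite lee_fin mulr_ge0.
(* On each level set the identity is the density formula for that set. *)
apply: eq_fsbigr => _ /[!inE] -[t _ <-]; set y := g t.
have my : measurable (g @^-1` [set y]) by [].
have y0 : 0 <= y by [].
under eq_integral do rewrite EFinM.
rewrite ge0_integralZl_EFin//; last first.
  by apply/measurable_EFinP; exact: measurable_indic.
rewrite integral_indic// P_density; last exact: measurableI.
under [RHS]eq_integral do rewrite -mulrA EFinM.
rewrite ge0_integralZl_EFin//; first 1 last.
- by move=> x _; rewrite lee_fin mulr_ge0.
- by apply/measurable_EFinP/measurable_funM => //; exact: measurable_indic.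
congr (_ * _)%E; rewrite setIC integral_mkcondr.
by apply: eq_integral => x _; rewrite patchE indicE; case: ifP => _;
  rewrite ?mul1r ?mul0r.
Qed.

(** Monotone convergence along simple functions, for an arbitrary measure [nu]:
    the density is given, not produced by a Radon-Nikodym theorem. *)
Lemma integral_density (D : set X) (f : X -> R) :
  measurable D -> (forall x, 0 <= f x) -> measurable_fun [set: X] f ->
  (\int[P]_(x in D) (f x)%:E = \int[nu]_(x in D) (f x * q x)%:E)%E.
Proof.
move=> mD f0 mf.
have mfE : measurable_fun [set: X] (EFin \o f) by exact/measurable_EFinP.
pose g := nnsfun_approx measurableT mfE.
have gf x : (g n x)%:E @[n --> \oo] --> (f x)%:E.
  by apply: (cvg_nnsfun_approx measurableT mfE) => // y _; rewrite lee_fin.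
have ndg x m n : (m <= n)%N -> g m x <= g n x.
  by move=> mn; exact/lefP/nd_nnsfun_approx.
transitivity (limn (fun n => \int[P]_(x in D) (g n x)%:E))%E.
  rewrite -monotone_convergence//.
  - by apply: eq_integral => x _; apply/esym/cvg_lim.
  - by move=> n; apply/measurable_EFinP; exact: measurable_funTS.
  - by move=> n x _; rewrite lee_fin.
  - by move=> x _ m n mn; rewrite lee_fin ndg.
under eq_fun do rewrite integral_density_nnsfun//.
rewrite -monotone_convergence//.
- apply: eq_integral => x _; apply/cvg_lim => //.
  under eq_fun do rewrite EFinM; rewrite EFinM.
  by apply: cvgeZr.
- by move=> n; apply/measurable_EFinP/measurable_funTS/measurable_funM.
- by move=> n x _; rewrite lee_fin mulr_ge0.
- by move=> x _ m n mn; rewrite lee_fin ler_wpM2r// ndg.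
Qed.

End integral_density.

(** * Numerical estimates for a quotient and for a logarithm *)

(** In the three lemmas below [w] is the norm of the parameter increment, [M] or
    [expR v] the total mass of the untilted density, [um] its linear part, [s] a
    bound on the first moments and [k] the constant of the quadratic remainders.
    The bound [w <= r] turns the quadratic remainder into a linear one, whence
    the constant [s + k * r]. *)
Lemma normalizer_bound (R : realFieldType) (k s r w M um : R) :
  0 <= k -> 0 <= s -> 0 <= w -> w <= r -> (s + k * r) * w <= 2^-1 ->
  `|M - 1 - um| <= k * w ^+ 2 -> `|um| <= s * w ->
  `|M - 1| <= (s + k * r) * w /\ 2^-1 <= M.
Proof.
move=> k0 s0 w0 wr cw; rewrite !ler_norml => /andP[M1 M2] /andP[u1 u2].
have : k * w ^+ 2 <= k * r * w by rewrite expr2 mulrA !ler_wpM2r// ler_wpM2l.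
by move=> kw; split; [apply/andP; split|]; lra.
Qed.

(** Multiplying the quantity to be bounded by [M] leaves the two given remainders
    and the product of [M - 1] with the linear term, all of second order; [M] is
    at least 1/2. *)
Lemma tilt_quotient_bound (R : realFieldType) (k s r w M Q P ub um : R) :
  0 <= k -> 0 <= s -> 0 <= P -> P <= 1 -> 0 < M -> 0 <= w ->
  w <= r -> (s + k * r) * w <= 2^-1 ->
  `|Q * M - P - ub| <= k * w ^+ 2 -> `|M - 1 - um| <= k * w ^+ 2 ->
  `|ub| <= s * w -> `|um| <= s * w ->
  `|Q - P - (ub - P * um)| <= (4 * k + 4 * (s + k * r) ^+ 2) * w ^+ 2.
Proof.
move=> k0 s0 P0 P1 M0 w0 wr cw QM Mum ubs ums.
have [M1 M2] := normalizer_bound k0 s0 w0 wr cw Mum ums.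
set c := s + k * r in cw M1 *.
have r0 : 0 <= r by exact: le_trans wr.
have sc : s <= c by rewrite lerDl mulr_ge0.
set N := (Q * M - P - ub) - P * (M - 1 - um) - (M - 1) * (ub - P * um).
have NE : (Q - P - (ub - P * um)) * M = N by rewrite /N; ring.
have ubum : `|ub - P * um| <= 2 * (c * w).
  apply: le_trans (ler_normB _ _) _; rewrite normrM (ger0_norm P0).
  have : P * `|um| <= `|um| by rewrite ler_piMl.
  have : s * w <= c * w by rewrite ler_wpM2r.
  by lra.
have Nle : `|N| <= (2 * k + 2 * c ^+ 2) * w ^+ 2.
  apply: le_trans (ler_normB _ _) _.
  have : `|(M - 1) * (ub - P * um)| <= (c * w) * (2 * (c * w)).
    by rewrite normrM ler_pM.
  have := ler_normB (Q * M - P - ub) (P * (M - 1 - um)).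
  have : `|P * (M - 1 - um)| <= k * w ^+ 2.
    by rewrite normrM (ger0_norm P0) (le_trans _ Mum)// ler_piMl.
  lra.
have : `|Q - P - (ub - P * um)| * M <= (2 * k + 2 * c ^+ 2) * w ^+ 2.
  by rewrite -(ger0_norm (ltW M0)) -normrM NE.
have := normr_ge0 (Q - P - (ub - P * um)).
nra.
Qed.

(** The two tangent inequalities [1 + v <= expR v] and [1 - v <= expR (- v)]
    squeeze [M - 1 - v] between 0 and [(M - 1) ^+ 2 / M], where [M = expR v]. *)
Lemma log_tilt_bound (R : realType) (k s r w v um : R) :
  0 <= k -> 0 <= s -> 0 <= w -> w <= r -> (s + k * r) * w <= 2^-1 ->
  `|expR v - 1 - um| <= k * w ^+ 2 -> `|um| <= s * w ->
  `|v - um| <= (4 * k + 4 * (s + k * r) ^+ 2) * w ^+ 2.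
Proof.
move=> k0 s0 w0 wr cw Mum ums.
have [M1 M2] := normalizer_bound k0 s0 w0 wr cw Mum ums.
set c := s + k * r in cw M1 *; set M := expR v in Mum M1 M2 *.
have vM : v <= M - 1 by have := expR_ge1Dx v; rewrite -/M; lra.
have Mv : 1 - v <= M^-1 by rewrite /M -expRN; have := expR_ge1Dx (- v); lra.
have M0 : 0 < M by exact: expR_gt0.
have MV : M * M^-1 = 1 by rewrite divff// gt_eqF.
have MV2 : M^-1 <= 2 by rewrite -[leRHS]invrK lef_pV2// posrE invr_gt0.
have M12 : (M - 1) ^+ 2 <= (c * w) ^+ 2.
  by rewrite -[leLHS]ger0_norm ?sqr_ge0// normrX lerXn2r ?nnegrE// (le_trans _ M1).
have gap : M - 1 - v <= 2 * (c * w) ^+ 2.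
  have -> : 2 * (c * w) ^+ 2 = (c * w) ^+ 2 * 2 by rewrite mulrC.
  apply: (@le_trans _ _ ((M - 1) ^+ 2 * M^-1)).
    have -> : (M - 1) ^+ 2 * M^-1 = M * (M * M^-1) - 2 * (M * M^-1) + M^-1 by ring.
    by rewrite MV; lra.
  by rewrite ler_pM ?sqr_ge0// invr_ge0 ltW.
have kw0 : 0 <= k * w ^+ 2 by rewrite mulr_ge0 ?sqr_ge0.
have cw0 : 0 <= c ^+ 2 * w ^+ 2 by rewrite -exprMn sqr_ge0.
rewrite exprMn in gap; move: Mum; rewrite !ler_norml => /andP[a b].
by apply/andP; split; lra.
Qed.

(** * Expansion of the partial Laplace transforms *)

(** The first-order Taylor remainder of the exponential, from the inequality
    [1 + y <= expR y] at [y] and at [- y] alone. *)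
Lemma expR_taylor1_le (R : realType) (y : R) :
  `|expR y - 1 - y| <= y ^+ 2 * expR `|y|.
Proof.
have ey := expR_ge1Dx y; have eNy := expR_ge1Dx (- y).
have eyK : expR y * expR (- y) = 1 by rewrite -expRD subrr expR0.
have e0 := expR_gt0 y.
rewrite ger0_norm; last by lra.
have upper : expR y - 1 <= y * expR y by nra.
have [y0|y0] := leP 0 y; first by rewrite ger0_norm//; nra.
have : 1 <= expR `|y| by rewrite -[leLHS]expR0 ler_expR.
by nra.
Qed.

Definition l1norm (R : realType) (p : nat) (u : 'rV[R]_p) : R :=
  \sum_(i < p) `|u 0 i|.

Section dotmul.
Context {R : realType} {p : nat}.
Implicit Types u v : 'rV[R]_p.

Lemma ler_dotmul u v : `|dotmul u v| <= `|u| * l1norm v.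
Proof.
rewrite /dotmul /l1norm mulr_sumr (le_trans (ler_norm_sum _ _ _))// ler_sum//.
by move=> i _; rewrite normrM ler_wpM2r// ler_norm_coord.
Qed.

Lemma dotmulDl u v w : dotmul (u + v) w = dotmul u w + dotmul v w.
Proof.
by rewrite /dotmul -big_split; apply: eq_bigr => i _; rewrite mxE mulrDl.
Qed.

Lemma ler_coord_l1norm u i : `|u 0 i| <= l1norm u.
Proof. by rewrite /l1norm (bigD1 i)//= lerDl sumr_ge0. Qed.

End dotmul.

Lemma ge0_subset_Rintegral d (X : measurableType d) (R : realType)
    (P : {measure set X -> \bar R}) (D : set X) (f : X -> R) :
  measurable D -> P.-integrable [set: X] (EFin \o f) ->
  (forall x, 0 <= f x) -> \int[P]_(x in D) f x <= \int[P]_x f x.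
Proof.
move=> mD intf f0.
have intfD : P.-integrable D (EFin \o f) by exact: integrableS intf.
rewrite fine_le ?integrable_fin_num//; apply: ge0_subset_integral => //.
  exact: measurable_int intf.
by move=> x _; rewrite lee_fin.
Qed.

Section laplace.
Context d (X : measurableType d) (R : realType) (p : nat).
Variables (P : probability X R) (T : X -> 'rV[R]_p) (r : R).
Hypothesis measurable_T : forall i, measurable_fun [set: X] (fun x => T x 0 i).
Hypothesis r_gt0 : 0 < r.

(* The factor 3 leaves room for the three factors of the remainder of
   exp(u.T): two powers of u.T and one exponential, each at most a power of
   exp(r |T|_1). *)
Let E x := expR (3 * r * l1norm (T x)).

Hypothesis integrable_E : P.-integrable [set: X] (EFin \o E).

Let l1_ge0 x : 0 <= l1norm (T x).
Proof. exact: sumr_ge0. Qed.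

Let rl1_ge0 x : 0 <= r * l1norm (T x).
Proof. by rewrite mulr_ge0// ltW. Qed.

Lemma measurable_dotmul u : measurable_fun [set: X] (fun x => dotmul u (T x)).
Proof. by apply: measurable_sum => i; exact: measurable_funM. Qed.

Let dominated_integrable (c : R) D (f : X -> R) : measurable D ->
  measurable_fun [set: X] f -> (forall x, `|f x| <= c * E x) ->
  P.-integrable D (EFin \o f).
Proof.
move=> mD mf fE; apply: (@integrableS _ _ _ P setT) => //.
apply: (le_integrable measurableT _ _ (integrableZl measurableT c integrable_E)).
  exact/measurable_EFinP.
by move=> x _; rewrite /= lee_fin (le_trans (fE x))// ler_norm.
Qed.

Let l1_le_E x : l1norm (T x) <= r^-1 * E x.
Proof.
rewrite -ler_pdivrMl ?invr_gt0// invrK.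
have /le_trans -> // : r * l1norm (T x) <= expR (r * l1norm (T x)).
  by have := expR_ge1Dx (r * l1norm (T x)); lra.
by rewrite ler_expR; have := rl1_ge0 x; lra.
Qed.

Lemma integrable_coord D i : measurable D ->
  P.-integrable D (EFin \o (fun x => T x 0 i)).
Proof.
move=> mD; apply: (@dominated_integrable r^-1) => // x.
exact: le_trans (ler_coord_l1norm _ _) (l1_le_E x).
Qed.

Lemma integrable_l1norm D : measurable D ->
  P.-integrable D (EFin \o (fun x => l1norm (T x))).
Proof.
move=> mD; apply: (@dominated_integrable r^-1) => // [|x].
  apply: measurable_sum => i; exact: measurableT_comp.
by rewrite ger0_norm.
Qed.

Lemma integrable_dotmul u D : measurable D ->
  P.-integrable D (EFin \o (fun x => dotmul u (T x))).
Proof.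
move=> mD; apply: (@dominated_integrable (`|u| * r^-1)) => // [|x].
  exact: measurable_dotmul.
by rewrite (le_trans (ler_dotmul _ _))// -mulrA ler_wpM2l.
Qed.

Lemma measurable_expR_dotmul u :
  measurable_fun [set: X] (fun x => expR (dotmul u (T x))).
Proof. by apply: measurableT_comp => //; exact: measurable_dotmul. Qed.

Lemma integrable_expR_dotmul u D : `|u| <= r -> measurable D ->
  P.-integrable D (EFin \o (fun x => expR (dotmul u (T x)))).
Proof.
move=> ur mD; apply: (@dominated_integrable 1) => // [|x].
  exact: measurable_expR_dotmul.
rewrite ger0_norm ?expR_ge0// mul1r ler_expR.
apply: le_trans (ler_norm _) _; apply: le_trans (ler_dotmul _ _) _.
have := ler_wpM2r (l1_ge0 x) ur; have := rl1_ge0 x; lra.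
Qed.

Lemma Rintegral_dotmul u D : measurable D ->
  \int[P]_(x in D) dotmul u (T x) =
  dotmul u (\row_i \int[P]_(x in D) T x 0 i).
Proof.
move=> mD; rewrite /Rintegral.
under eq_integral do rewrite /dotmul -sumEFin.
rewrite integral_sum//; last first.
  move=> i; under eq_fun do rewrite EFinM.
  exact/integrableZl/integrable_coord.
under eq_bigr => i _.
  under eq_integral do rewrite EFinM.
  rewrite integralZl//; last exact: integrable_coord.
  over.
rewrite -sum_fine//=; last first.
  by move=> i _; rewrite fin_numM// integrable_fin_num//; exact: integrable_coord.
apply: eq_bigr => i _; rewrite mxE fineM// integrable_fin_num//.
exact: integrable_coord.
Qed.

Definition laplace_remainder : R := r^-1 ^+ 2 * \int[P]_x E x.

(** Integrating the pointwise Taylor bound: the remainder is at most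
    [(`|u| / r) ^+ 2 * E x], and the integral of [E] over [D] is at most its
    integral over the whole space, so the constant is the same for all [D]. *)
Lemma laplace_expansion u D : `|u| <= r -> measurable D ->
  `|\int[P]_(x in D) expR (dotmul u (T x)) - fine (P D)
    - dotmul u (\row_i \int[P]_(x in D) T x 0 i)|
  <= laplace_remainder * `|u| ^+ 2.
Proof.
move=> ur mD.
have intexp := integrable_expR_dotmul ur mD.
have intdot := integrable_dotmul u mD.
have int1 : P.-integrable D (EFin \o cst (1 : R)).
  exact: finite_measure_integrable_cst.
have PD : fine (P D) = \int[P]_(x in D) (1 : R).
  by rewrite Rintegral_cst// mul1r.
rewrite PD -Rintegral_dotmul// -RintegralB// -RintegralB//; last first.
  exact: (integrableB mD intexp int1).
set F := fun x => expR (dotmul u (T x)) - 1 - dotmul u (T x).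
have mF : measurable_fun [set: X] F.
  apply: measurable_funB; last exact: measurable_dotmul.
  by apply: measurable_funB => //; exact: measurable_expR_dotmul.
set c := r^-1 ^+ 2 * `|u| ^+ 2.
have FE x : `|F x| <= c * E x.
  apply: le_trans (expR_taylor1_le _) _.
  set z := r * l1norm (T x).
  have z0 : 0 <= z by exact: rl1_ge0.
  have dz : `|dotmul u (T x)| <= `|u| / r * z.
    by rewrite /z mulrA divfK ?gt_eqF// ler_dotmul.
  have ->: E x = expR z ^+ 2 * expR z.
    by rewrite -exprSr -expRM_natl /E /z mulrA.
  have ze : z <= expR z by have := expR_ge1Dx z; lra.
  rewrite mulrA ler_pM ?sqr_ge0 ?expR_ge0//.
    rewrite -[leLHS]ger0_norm ?sqr_ge0// normrX (_ : c = (`|u| / r) ^+ 2); last first.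
      by rewrite /c exprMn mulrC.
    rewrite -exprMn lerXn2r ?nnegrE ?(le_trans _ dz)//.
      by rewrite !mulr_ge0 ?expR_ge0 ?invr_ge0// ltW.
    by rewrite (le_trans dz)// ler_wpM2l// mulr_ge0 ?invr_ge0// ltW.
  rewrite ler_expR (le_trans (ler_dotmul _ _))// /z ler_wpM2r//.
have intED : P.-integrable D (EFin \o E) by exact: integrableS integrable_E.
have intF : P.-integrable D (EFin \o F) by exact: dominated_integrable FE.
apply: le_trans (le_normr_Rintegral mD intF) _.
apply: (@le_trans _ _ (\int[P]_(x in D) (c * E x))).
  apply: le_Rintegral => //; last exact: (integrableZl mD c intED).
  exact: (integrable_abse intF).
rewrite RintegralZl// [leRHS]mulrAC ler_wpM2l//.
  by rewrite /c mulr_ge0 ?sqr_ge0.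
by apply: ge0_subset_Rintegral => // x; rewrite expR_ge0.
Qed.

Let m : 'rV[R]_p := \row_i \int[P]_x T x 0 i.

Lemma ler_dotmul_Rintegral u D : measurable D ->
  `|dotmul u (\row_i \int[P]_(x in D) T x 0 i)|
    <= (\int[P]_x l1norm (T x)) * `|u|.
Proof.
move=> mD; rewrite -Rintegral_dotmul//.
have intl1 := integrable_l1norm mD.
apply: le_trans (le_normr_Rintegral mD (integrable_dotmul u mD)) _.
apply: (@le_trans _ _ (\int[P]_(x in D) (`|u| * l1norm (T x)))).
  apply: le_Rintegral => //; last by move=> x _; exact: ler_dotmul.
    exact: (integrable_abse (integrable_dotmul u mD)).
  exact: (integrableZl mD `|u| intl1).
rewrite RintegralZl// mulrC ler_wpM2r//.
by apply: ge0_subset_Rintegral => //; exact: integrable_l1norm.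
Qed.

(** [Q] is the probability measure obtained by tilting [P] with the density
    [expR (u.T - v)].  Its total mass being 1 forces [expR v] to be the Laplace
    transform of [T] at [u]: the estimate on [v] is that of a logarithm, and the
    estimate on [Q D] that of a quotient of two Laplace transforms. *)
Lemma tilt_expansion : exists r' C : R, [/\ 0 < r', r' <= r, 0 <= C &
  forall u v (Q : set X -> \bar R), `|u| <= r' -> Q [set: X] = 1%E ->
  (forall D, measurable D ->
    Q D = (\int[P]_(x in D) (expR (dotmul u (T x) - v))%:E)%E) ->
  `|v - dotmul u m| <= C * `|u| ^+ 2 /\
  forall D, measurable D ->
    `|fine (Q D) - fine (P D)
      - dotmul u (\row_i \int[P]_(x in D) (T x 0 i - m 0 i))|
    <= C * `|u| ^+ 2].
Proof.
set s := \int[P]_x l1norm (T x); set k := laplace_remainder.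
have s0 : 0 <= s by apply: Rintegral_ge0.
have k0 : 0 <= k.
  by rewrite mulr_ge0 ?sqr_ge0//; apply: Rintegral_ge0 => x _; exact: expR_ge0.
set c := s + k * r.
have c0 : 0 <= c by rewrite addr_ge0// mulr_ge0// ltW.
exists (Num.min r (2 * c + 1)^-1), (4 * k + 4 * c ^+ 2); split.
(* The bound 1 / (2 c + 1) on |u| keeps the total mass expR v above 1/2. *)
- by rewrite lt_min r_gt0 invr_gt0; lra.
- by rewrite ge_min lexx.
- by rewrite addr_ge0// mulr_ge0// sqr_ge0.
move=> u v Q; rewrite le_min => /andP[ur uc] Q1 QE.
have cu : c * `|u| <= 2^-1.
  rewrite -(@ler_pM2r _ (2 * c + 1)) in uc; last lra.
  by rewrite mulVf in uc; [have := normr_ge0 u; lra|lra].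
have QM D : measurable D ->
    fine (Q D) * expR v = \int[P]_(x in D) expR (dotmul u (T x)).
  move=> mD; rewrite QE//.
  have -> : fine (\int[P]_(x in D) (expR (dotmul u (T x) - v))%:E)%E
      = \int[P]_(x in D) (expR (dotmul u (T x)) * expR (- v)).
    by congr fine; apply: eq_integral => x _; rewrite expRD.
  rewrite RintegralZr//; last exact: integrable_expR_dotmul.
  by rewrite -mulrA -expRD addNr expR0 mulr1.
have Mexp := laplace_expansion ur measurableT.
rewrite -QM// Q1 probability_setT/= mul1r -/m -/k in Mexp.
have um := ler_dotmul_Rintegral u measurableT.
rewrite -/m -/s in um.
split.
  exact: (log_tilt_bound k0 s0 (normr_ge0 u) ur cu Mexp um).
move=> D mD.
have -> : dotmul u (\row_i \int[P]_(x in D) (T x 0 i - m 0 i)) =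
    dotmul u (\row_i \int[P]_(x in D) T x 0 i) - fine (P D) * dotmul u m.
  rewrite /dotmul mulr_sumr -sumrB; apply: eq_bigr => i _; rewrite !mxE.
  rewrite RintegralB//; [|exact: integrable_coord|].
    by rewrite Rintegral_cst// mulrBr; congr (_ - _); rewrite mulrA [RHS]mulrC.
  exact: finite_measure_integrable_cst.
have Lexp := laplace_expansion ur mD.
rewrite -QM// -/k in Lexp.
have ub := ler_dotmul_Rintegral u mD.
have P0 : 0 <= fine (P D) by exact: fine_ge0.
have P1 : fine (P D) <= 1.
  by rewrite -lee_fin fineK ?fin_num_measure//; exact: probability_le1.
exact: (tilt_quotient_bound k0 s0 P0 P1 (expR_gt0 v) (normr_ge0 u) ur cu Lexp Mexp ub um).
Qed.

End laplace.

(** * Exponential moments, measurability and bounded functions *)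

Lemma ler_rV_norm (R : realType) (p : nat) (u : 'rV[R]_p) (c : R) :
  0 <= c -> (forall i, `|u 0 i| <= c) -> `|u| <= c.
Proof.
move=> c0 uc; rewrite [leLHS]mx_normrE; apply: bigmax_le => // -[i j] _ /=.
by rewrite (ord1 i).
Qed.

(** The supremum over the cube of half-side [r] of the linear form [u.T] is
    [r * l1norm T], attained at the corner that has the signs of [T]; the maximum
    over the finitely many corners is at most the sum. *)
Lemma integrable_expR_l1norm d (X : measurableType d) (R : realType) (p : nat)
    (P : {measure set X -> \bar R}) (T : X -> 'rV[R]_p) (r : R) :
  (forall i, measurable_fun [set: X] (fun x => T x 0 i)) -> 0 <= r ->
  (forall u, `|u| <= r ->
    P.-integrable [set: X] (EFin \o (fun x => expR (dotmul u (T x))))) ->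
  P.-integrable [set: X] (EFin \o (fun x => expR (r * l1norm (T x)))).
Proof.
move=> mT r0 int_exp.
pose corner (b : {ffun 'I_p -> bool}) : 'rV[R]_p := \row_i (r * (-1) ^+ b i).
pose S x := \sum_(b : {ffun 'I_p -> bool}) expR (dotmul (corner b) (T x)).
have corner_le b : `|corner b| <= r.
  by apply: ler_rV_norm => // i; rewrite mxE normrM normr_sign mulr1 ger0_norm.
have intS : P.-integrable [set: X] (EFin \o S).
  rewrite (_ : EFin \o S = fun x => (\sum_(b : {ffun 'I_p -> bool})
      (expR (dotmul (corner b) (T x)))%:E)%E); last first.
    by apply/funext => x; rewrite /= sumEFin.
  by apply: integrable_sum => // b _; exact: int_exp.
apply: (le_integrable measurableT _ _ intS).
  apply/measurable_EFinP/measurableT_comp => //; apply: measurable_funM => //.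
  by apply: measurable_sum => i; exact: measurableT_comp.
move=> x _; rewrite /= lee_fin ger0_norm ?expR_ge0// ger0_norm; last first.
  by apply: sumr_ge0 => b _; exact: expR_ge0.
pose b := [ffun i => T x 0 i < 0].
rewrite (_ : r * _ = dotmul (corner b) (T x)).
  rewrite /S (bigD1 b)//= lerDl sumr_ge0// => c _; exact: expR_ge0.
rewrite /l1norm mulr_sumr; apply: eq_bigr => i _.
by rewrite !mxE ffunE -mulrA normrEsign.
Qed.

Lemma measurable_coord (R : realType) (p : nat) i :
  measurable_fun [set: borel 'rV[R]_p] (fun u : 'rV[R]_p => u 0 i).
Proof.
apply: (measurability _ (RGenOpens.measurableE R)).
move=> _ [_ [a [b ->] <-]]; rewrite setTI; apply: sub_gen_smallest.
move/continuousP: (@coord_continuous R 1 p 0 i); apply; exact: interval_open.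
Qed.

Section linfty_combination.
Context {R : realType} {Z : Type}.

Lemma linfty_sumE (I : Type) (s : seq I) (F : I -> linfty Z R) z :
  (\sum_(i <- s) F i) z = \sum_(i <- s) F i z.
Proof. by apply: (big_morph (fun f : linfty Z R => f z)). Qed.

Lemma row_combination_linftyE (p : nat) (e : 'I_p -> linfty Z R) u z :
  row_combination e u z = dotmul u (\row_i e i z).
Proof. by rewrite linfty_sumE; apply: eq_bigr => i _; rewrite mxE. Qed.

End linfty_combination.

Lemma row_combination_realE (R : realType) (p : nat) (e : 'I_p -> R) u :
  row_combination (W := R) e u = dotmul u (\row_i e i).
Proof. by apply: eq_bigr => i _; rewrite mxE. Qed.

Lemma dotmulC (R : realType) (p : nat) (u v : 'rV[R]_p) :
  dotmul u v = dotmul v u.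
Proof. by apply: eq_bigr => i _; rewrite mulrC. Qed.

(** * Differentiability of the distance profiles *)

Theorem proposition4p2 (R : realType) (Omega : pmetricType R) (p : nat)
  (H : set 'rV[R]_p)
  (nu : {measure set (borel Omega) -> \bar R})
  (h : Omega -> R) (T : Omega -> 'rV[R]_p) (A : 'rV[R]_p -> R)
  (mu : 'rV[R]_p -> probability (borel Omega) R)
  (separable_Omega : separable Omega)
  (open_H : open H)
  (h_ge0 : forall x, 0 <= h x)
  (measurable_h : measurable_fun [set: borel Omega] (h : borel Omega -> R))
  (measurable_T :
    measurable_fun [set: borel Omega] (T : borel Omega -> borel 'rV[R]_p))
  (mu_density : forall eta, H eta ->
    forall B : set (borel Omega), measurable B ->
      mu eta B = (\int[nu]_(x in B) (expfam_density h T A eta x)%:E)%E)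
  (fisher_nonsingular : forall eta, H eta ->
    fisher_information A eta \in unitmx)
  (eta0 : 'rV[R]_p) (H_eta0 : H eta0) :
  [/\ differentiable
        (fun eta : 'rV[R]_p => distance_profile_linfty (mu eta)) eta0,
      forall (omega : Omega) (t : R), 0 <= t -> forall i : 'I_p,
        derivable (fun eta : 'rV[R]_p => distance_profile (mu eta) omega t)
          eta0 (delta_mx 0 i),
      forall e : R, 0 < e ->
        \forall eta \near within H (nbhs eta0),
          (ereal_sup [set (`|distance_profile (mu eta) z.1 z.2
                            - distance_profile (mu eta0) z.1 z.2
                            - dotmul (distance_profile_dot mu eta0 z.1 z.2)
                                (eta - eta0)|%R)%:E
                     | z in [set z : Omega * R | (0 <= z.2)%R]]
           <= (e * `|eta - eta0|)%R%:E)%E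
    & forall (omega : Omega) (t : R), 0 <= t -> forall i : 'I_p,
        (distance_profile_dot mu eta0 omega t 0 i)%:E =
        ('E_(mu eta0)[(fun x => \1_(mball omega t) x
                                * score T A eta0 x 0 i)%R])%E].
Proof.
pose P := mu eta0.
have mTi i : measurable_fun [set: borel Omega]
    (fun x : borel Omega => T x 0 i).
  exact: (measurableT_comp (measurable_coord (R:=R) i) measurable_T).
have [dlt d0 dH] : exists2 dlt : R, 0 < dlt &
    forall u, `|u| <= dlt -> H (eta0 + u).
  have /nbhs_normP[e e0 eH] : nbhs eta0 H by exact: open_nbhs_nbhs.
  exists (e / 2) => [|u ue]; first by rewrite divr_gt0.
  apply: eH; rewrite /= opprD addrA subrr sub0r normrN.
  by apply: le_lt_trans ue _; rewrite ltr_pdivrMr// ltr_pMr// ltr1n.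
have mdens : measurable_fun [set: borel Omega]
    (expfam_density h T A eta0 : borel Omega -> R).
  apply: measurable_funM => //; apply: measurableT_comp => //.
  by apply: measurable_funB => //; exact: measurable_dotmul.
(* The densities at eta0 + u and at eta0 differ by the factor exp(u.T - v). *)
have tilt u : `|u| <= dlt -> forall D : set (borel Omega), measurable D ->
    mu (eta0 + u) D =
    (\int[P]_(x in D) (expR (dotmul u (T x) - (A (eta0 + u) - A eta0)))%:E)%E.
  move=> ud D mD; rewrite mu_density//; last exact: dH.
  rewrite (@integral_density _ _ _ nu P (expfam_density h T A eta0))//.
  - apply: eq_integral => x _; congr EFin.
    rewrite /expfam_density mulrCA -expRD dotmulDl; congr (_ * expR _); ring.
  - by move=> x; rewrite mulr_ge0// expR_ge0.
  - exact: mu_density.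
  - apply: measurableT_comp => //.
    by apply: measurable_funB => //; exact: measurable_dotmul.
(* The tilt by u has total mass 1, hence exp(u.T) is integrable. *)
have int_exp u : `|u| <= dlt -> P.-integrable [set: borel Omega]
    (EFin \o (fun x => expR (dotmul u (T x)))).
  move=> ud; set v := A (eta0 + u) - A eta0.
  have int_tilt : P.-integrable [set: borel Omega]
      (EFin \o (fun x => expR (dotmul u (T x) - v))).
    apply/integrableP; split.
      apply/measurable_EFinP/measurableT_comp => //.
      by apply: measurable_funB => //; exact: measurable_dotmul.
    under eq_integral do rewrite /= ger0_norm ?expR_ge0//.
    by rewrite -tilt// probability_setT ltry.
  apply: eq_integrable (integrableZl measurableT (expR v) int_tilt) => // x _.
  by rewrite /= -EFinM -expRD addrC subrK.
pose r := dlt / 3.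
have r0 : 0 < r by rewrite divr_gt0.
have intE : P.-integrable [set: borel Omega]
    (EFin \o (fun x => expR (3 * r * l1norm (T x)))).
  rewrite /r mulrC divfK//.
  exact: integrable_expR_l1norm mTi (ltW d0) int_exp.
have [r' [C [r'0 r'r C0 key]]] := tilt_expansion mTi r0 intE.
set m := (\row_i _) in key.
have r'd : r' <= dlt by rewrite /r in r'r; lra.
pose S (D : set (borel Omega)) i := \int[P]_(x in D) (T x 0 i - m 0 i).
have Aexp u : `|u| <= r' ->
    `|A (eta0 + u) - A eta0 - dotmul u m| <= C * `|u| ^+ 2.
  move=> ur; have ud := le_trans ur r'd.
  have [] // := key u (A (eta0 + u) - A eta0) (mu (eta0 + u)) ur.
    exact: probability_setT.
  exact: tilt.
have Fexp u D : `|u| <= r' -> measurable D ->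
    `|fine (mu (eta0 + u) D) - fine (mu eta0 D) - dotmul u (\row_i S D i)|
    <= C * `|u| ^+ 2.
  move=> ur mD; have ud := le_trans ur r'd.
  have [] // := key u (A (eta0 + u) - A eta0) (mu (eta0 + u)) ur.
  - exact: probability_setT.
  - exact: tilt.
  - by move=> _; apply.
have gradA : gradient A eta0 = m.
  have [|_ dA] := @differentiable_quadratic_remainder R p R A eta0 (m 0) r' C r'0.
    move=> u ur; rewrite row_combination_realE.
    rewrite (_ : \row_i m 0 i = m); last by apply/rowP => i; rewrite mxE.
    exact: Aexp.
  by apply/rowP => i; rewrite mxE; exact: dA.
have int_score i D : measurable D ->
    P.-integrable D (EFin \o (fun x => T x 0 i - m 0 i)).
  move=> mD; have intT := integrable_coord mTi r0 intE i mD.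
  have intm : P.-integrable D (EFin \o cst (m 0 i)).
    exact: finite_measure_integrable_cst.
  exact: (integrableB mD intT intm).
have dF omega t := @differentiable_quadratic_remainder R p R
  (fun eta => distance_profile (mu eta) omega t) eta0
  (S (mball omega t)) r' C r'0.
have {}dF omega t : differentiable
    (fun eta => distance_profile (mu eta) omega t : R) eta0 /\
    (forall i, 'D_(delta_mx 0 i)
      (fun eta => distance_profile (mu eta) omega t) eta0 =
      S (mball omega t) i).
  apply: dF => u ur; rewrite row_combination_realE.
  exact: Fexp (mball_measurable _ _).
have dotE omega t : distance_profile_dot mu eta0 omega t =
    \row_i S (mball omega t) i.
  by apply/rowP => i; rewrite !mxE; apply: (dF omega t).2.
split.
- have S_bounded i : (fun z : Omega * {nonneg R} =>
      S (mball z.1 z.2%:num) i) \in @linfty_pred (Omega * {nonneg R}) R.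
    apply/asboolP; exists (\int[P]_x `|T x 0 i - m 0 i|) => _ /= [z _ <-].
    have mD := mball_measurable z.1 z.2%:num.
    apply: le_trans (le_normr_Rintegral mD (int_score i _ mD)) _.
    apply: ge0_subset_Rintegral => //.
    exact: (integrable_abse (int_score i _ measurableT)).
  apply: (@differentiable_quadratic_remainder R p _ _ eta0
    (fun i => Linfty (S_bounded i)) r' C r'0 _).1 => u ur.
  apply: linfty_norm_le => [|z]; first by rewrite mulr_ge0 ?sqr_ge0.
  (* The vector space operations on bounded functions are pointwise. *)
  rewrite [X in `|X|](_ : _ = distance_profile (mu (eta0 + u)) z.1 z.2%:num
    - distance_profile (mu eta0) z.1 z.2%:num
    - row_combination (fun i => Linfty (S_bounded i)) u z)//.
  rewrite row_combination_linftyE.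
  exact: Fexp (mball_measurable _ _).
- by move=> omega t _ i; apply: diff_derivable; exact: (dF omega t).1.
- move=> e e0; rewrite near_withinE; apply/(@nbhs_normP _ 'rV[R]_p).
  have C1 : 0 < C + 1 by rewrite ltr_wpDl.
  (* C |u|^2 <= e |u| as soon as (C + 1) |u| <= e; adding 1 keeps the divisor
     positive. *)
  exists (Num.min r' (e / (C + 1))).
    by rewrite /= lt_min r'0 divr_gt0.
  move=> eta; rewrite /= distrC lt_min => /andP[etar etae] _.
  apply: ge_ereal_sup => _ [[omega t] /= _ <-]; rewrite lee_fin.
  have := Fexp (eta - eta0) _ (ltW etar) (mball_measurable omega t).
  rewrite [eta0 + _]addrC subrK dotE dotmulC => /le_trans -> //.
  rewrite expr2 mulrA ler_wpM2r//.
  move: etae; rewrite ltr_pdivlMr// => /ltW /(le_trans _) -> //.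
  by rewrite mulrC ler_wpM2l// lerDl.
- move=> omega t _ i; rewrite dotE mxE unlock /S.
  have mD := mball_measurable omega t.
  rewrite fineK; last exact: (integrable_fin_num mD (int_score i _ mD)).
  rewrite integral_mkcond; apply: eq_integral => x _.
  rewrite patchE indicE /score gradA !mxE.
  by case: ifPn => _; rewrite ?mul1r ?mul0r.
Qed.
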